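(* Let $n\ge 1$, $A\in\mathbb{C}^{n\times n}$, and let $f_A(Q)=\|\mathcal{N}(Q^*AQ)\|_F^2$ for $Q\in U(n)$, viewed also as a function of $[Q]\in\mathcal{F}_n=U(n)/U(1)^n$. The global maximum of $f_A$ is equal to $$\max f_A=\|A\|_F^2-\frac1n|\mathrm{trace}(A)|^2 .$$ Moreover, if $n\ge 3$ then, for almost every $A\in\mathbb{C}^{n\times n}$, this maximum value is attained at uncountably many $[Q]\in\mathcal{F}_n$.
   Context: $U(n)$ is the group of $n\times n$ unitary matrices. $X^*$ is the conjugate transpose and $\|X\|_F^2=\mathrm{trace}(X^*X)$ the squared Frobenius norm. $\mathrm{diag}(X)$ denotes the diagonal matrix whose diagonal entries coincide with those of $X$, and $\mathcal{N}(X):=X-\mathrm{diag}(X)$. The flag manifold $\mathcal{F}_n:=U(n)/U(1)^n$ is the quotient of $U(n)$ by right multiplication by diagonal unitary matrices; $[Q]$ is the class of $Q$. The function $f_A$ is constant on these classes, hence is also regarded as a function on $\mathcal{F}_n$. ''Almost every'' refers to Lebesgue measure on $\mathbb{C}^{n\times n}\cong\mathbb{R}^{2n^2}$. *)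

(* Defs.v *)
From HB Require Import structures.
From mathcomp Require Import all_boot all_order all_algebra generic_quotient.
From mathcomp Require Import spectral complex.
From mathcomp Require Import all_classical all_reals all_analysis.

Set Implicit Arguments.
Unset Strict Implicit.
Unset Printing Implicit Defensive.

Import Order.TTheory GRing.Theory Num.Theory.
Import numFieldNormedType.Exports.

Local Open Scope classical_set_scope.
Local Open Scope ring_scope.
Local Open Scope complex_scope.
Local Open Scope sesquilinear_scope.
Local Open Scope quotient_scope.

Section flag_manifold.
Context {R : realType} {n : nat}.

Record unitary_group := UnitaryGroup {
  umx :> 'M[R[i]]_n ; _ : umx \is unitarymx }.
HB.instance Definition _ := [isSub for umx].
HB.instance Definition _ := [Choice of unitary_group by <:].

(* P and Q have the same class in U(n)/U(1)^n: the torus U(1)^n is embedded as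
   the diagonal unitary matrices and acts by right multiplication. *)
Definition flag_rel (P Q : unitary_group) : bool :=
  `[< exists2 D : 'M[R[i]]_n, is_diag_mx D && (D \is unitarymx) &
      umx Q = umx P *m D >].

Lemma flag_rel_refl : reflexive flag_rel.
Proof.
move=> P; apply/asboolP; exists 1%:M; last by rewrite mulmx1.
rewrite scalar_mx_is_diag; apply/unitarymxP.
by rewrite trmx1 map_mx1 mulmx1.
Qed.

Lemma flag_rel_impl (P Q : unitary_group) : flag_rel P Q -> flag_rel Q P.
Proof.
move=> /asboolP[D /andP[/is_diag_mxP dD uD] QE]; apply/asboolP; exists (D ^t*).
  rewrite trmxC_unitary uD andbT; apply/is_diag_mxP => i j ij.
  by rewrite !mxE dD ?conjC0// eq_sym.
by rewrite QE -mulmxA (unitarymxP uD) mulmx1.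
Qed.

Lemma flag_rel_sym : symmetric flag_rel.
Proof. by move=> P Q; apply/idP/idP; exact: flag_rel_impl. Qed.

Lemma flag_rel_trans : transitive flag_rel.
Proof.
move=> Q P S /asboolP[D /andP[/diag_mxP[d ->] uD] QE].
move=> /asboolP[E /andP[/diag_mxP[e ->] uE] SE]; apply/asboolP.
exists (diag_mx d *m diag_mx e); last by rewrite SE QE mulmxA.
by rewrite mul_unitarymx// andbT mulmx_diag diag_mx_is_diag.
Qed.

Canonical flag_equiv :=
  EquivRel flag_rel flag_rel_refl flag_rel_sym flag_rel_trans.

Definition flag := {eq_quot flag_rel}.
HB.instance Definition _ := EqQuotient.on flag.
HB.instance Definition _ := Choice.on flag.

End flag_manifold.
Arguments unitary_group R n : clear implicits.
Arguments flag R n : clear implicits.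

Section objective.
Context {R : realType} {n : nat}.
Implicit Types A X Y : 'M[R[i]]_n.

(* Squared norms are real, but are typed in R[i] as `|_| is; there, x <= y
   means that y - x is a nonnegative real number. *)
Definition frob2 X : R[i] := \tr (X ^t* *m X).

Definition diagpart X : 'M[R[i]]_n := diag_mx (\row_i X i i).

Definition offdiag X : 'M[R[i]]_n := X - diagpart X.

Definition fA A (Q : unitary_group R n) : R[i] :=
  frob2 (offdiag (Q ^t* *m A *m Q)).

(* Independent of the representative: see flag_fAE. *)
Definition flag_fA A (q : flag R n) : R[i] := fA A (repr q).

Lemma frob2_unitary X (D : 'M[R[i]]_n) : D \is unitarymx ->
  frob2 (D ^t* *m X *m D) = frob2 X.
Proof.
move=> /unitarymxP uD; rewrite /frob2 !trmx_mul !map_mxM /= trmxCK.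
rewrite -!mulmxA mxtrace_mulC -!mulmxA (mulmxA D (D ^t*)) uD mul1mx.
by rewrite mulmx1.
Qed.

Lemma diagpart_conj_diag X (D : 'M[R[i]]_n) :
  is_diag_mx D ->
  diagpart (D ^t* *m X *m D) = D ^t* *m diagpart X *m D.
Proof.
move=> /diag_mxP[d ->]; rewrite tr_diag_mx map_diag_mx /=.
apply/matrixP => i j; rewrite /diagpart -[in RHS]mulmxA !mulmx_diag !mxE.
congr (_ *+ _); rewrite (bigD1 i)//= big1 ?addr0 => [|k ki]; last first.
  by rewrite !mxE (negPf ki) mulr0.
by rewrite mul_diag_mx !mxE eqxx mulr1n mulrA.
Qed.

Lemma flag_fAE A (Q : unitary_group R n) :
  flag_fA A (\pi_(flag R n) Q) = fA A Q.
Proof.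
rewrite /flag_fA; have : flag_rel Q (repr (\pi_(flag R n) Q)).
  by apply/(@eqquotP _ _ (flag R n)); rewrite reprK.
move=> /asboolP[D /andP[dD uD] QE]; rewrite /fA QE.
rewrite -[RHS](frob2_unitary _ uD); congr frob2.
rewrite (_ : (_ *m D) ^t* *m A *m _ = D ^t* *m (Q ^t* *m A *m Q) *m D).
  by rewrite /offdiag diagpart_conj_diag// mulmxBr mulmxBl.
by rewrite trmx_mul map_mxM !mulmxA.
Qed.

End objective.

Section lebesgue_tuple.
Context {R : realType}.
Local Open Scope ereal_scope.
Local Notation T := (measurableTypeR R).

Definition tcons n (p : T * n.-tuple T) : n.+1.-tuple T :=
  [tuple of p.1 :: p.2].

Definition tuncons n (t : n.+1.-tuple T) : T * n.-tuple T :=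
  (thead t, [tuple of behead t]).

Lemma tconsK n : cancel (@tcons n) (@tuncons n).
Proof. by move=> [x t]; congr pair; apply/val_inj. Qed.

Lemma tunconsK n : cancel (@tuncons n) (@tcons n).
Proof. by move=> t; rewrite /tcons /tuncons/= -tuple_eta. Qed.

Lemma measurable_tcons n : measurable_fun setT (@tcons n).
Proof. exact: measurable_cons. Qed.

Lemma measurable_tuncons n : measurable_fun setT (@tuncons n).
Proof.
apply: measurable_fun_pair; last exact: measurable_behead.
exact: (measurable_tnth ord0).
Qed.

Section step.
Variables (n : nat) (mu : {sigma_finite_measure set (n.-tuple T) -> \bar R}).

Definition lebesgue_cons : set (n.+1.-tuple T) -> \bar R :=
  pushforward (lebesgue_measure \x mu) (@tcons n).

Let mtcons (A : set (n.+1.-tuple T)) :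
  measurable A -> measurable (@tcons n @^-1` A).
Proof.
by move=> mA; rewrite -[X in measurable X]setTI; exact: measurable_tcons.
Qed.

Let lebesgue_cons0 : lebesgue_cons set0 = 0.
Proof. by rewrite /lebesgue_cons /pushforward preimage_set0 measure0. Qed.

Let lebesgue_cons_ge0 A : 0 <= lebesgue_cons A.
Proof. by rewrite /lebesgue_cons /pushforward measure_ge0. Qed.

Let lebesgue_cons_sigma_additive : semi_sigma_additive lebesgue_cons.
Proof.
move=> F mF tF mUF; rewrite /lebesgue_cons /pushforward preimage_bigcup.
apply: measure_semi_sigma_additive.
- by move=> k; exact: mtcons.
- apply/trivIsetP => /= i j _ _ ij; rewrite -preimage_setI.
  by move/trivIsetP : tF => /(_ _ _ _ _ ij) ->//; rewrite preimage_set0.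
- by rewrite -preimage_bigcup; exact: mtcons.
Qed.

HB.instance Definition _ := isMeasure.Build _ _ _ lebesgue_cons
  lebesgue_cons0 lebesgue_cons_ge0 lebesgue_cons_sigma_additive.

Let lebesgue_cons_sigma_finite : sigma_finite setT lebesgue_cons.
Proof.
have /sigma_finiteP[F [FT ndF Foo]] := sigma_finiteT (@lebesgue_measure R).
have /sigma_finiteP[G [GT ndG Goo]] := sigma_finiteT mu.
exists (fun k => @tuncons n @^-1` (F k `*` G k)).
  rewrite -preimage_bigcup -[LHS](preimage_setT (@tuncons n)); congr preimage.
  apply/esym/seteqP; split => // -[x t] _.
  have [k _ Fx] : (\bigcup_k F k) x by rewrite -FT.
  have [l _ Gt] : (\bigcup_k G k) t by rewrite -GT.
  exists (maxn k l) => //; split => /=.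
    by move: Fx; exact/subsetPset/ndF/leq_maxl.
  by move: Gt; exact/subsetPset/ndG/leq_maxr.
move=> k; have [mF Fk] := Foo k; have [mG Gk] := Goo k; split.
  rewrite -[X in measurable X]setTI.
  by apply: measurable_tuncons => //; exact: measurableX.
rewrite /lebesgue_cons /pushforward -comp_preimage.
rewrite (_ : _ \o _ = id); last by apply/funext => p; exact: tconsK.
by rewrite preimage_id product_measure1E// lte_mul_pinfty// ge0_fin_numE.
Qed.

HB.instance Definition _ := Measure_isSigmaFinite.Build _ _ _ lebesgue_cons
  lebesgue_cons_sigma_finite.

End step.

(* The n-fold product of the Lebesgue measure on R, transported along the
   bijections R * R^m -> R^(m+1); see lebesgue_tuple_box. *)
Fixpoint lebesgue_tuple n : {sigma_finite_measure set (n.-tuple T) -> \bar R} :=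
  if n is m.+1 then lebesgue_cons (lebesgue_tuple m) else \d_[tuple].

Lemma lebesgue_tuple_box n (A : 'I_n -> set T) :
  (forall i, measurable (A i)) ->
  lebesgue_tuple n [set t | forall i, A i (tnth t i)] =
  \prod_(i < n) lebesgue_measure (A i).
Proof.
elim: n A => [|n IH] A mA.
  by rewrite big_ord0 /= diracE mem_set// => -[].
rewrite big_ord_recl /= /lebesgue_cons /pushforward.
rewrite (_ : _ @^-1` _ =
  A ord0 `*` [set t | forall i, A (lift ord0 i) (tnth t i)]); last first.
  apply/seteqP; split => [[x t] /= H|[x t] /= [H0 H] i].
    by split => [|i]; [exact: (H ord0)|have := H (lift ord0 i); rewrite tnthS].
  by case: (unliftP ord0 i) => [j|] ->//; rewrite tnthS.
rewrite product_measure1E//.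
  congr (_ * _); exact: (IH (A \o lift ord0) (fun i => mA _)).
rewrite (_ : mkset _ = \bigcap_(i in [set: 'I_n])
   ((fun t : n.-tuple T => tnth t i) @^-1` A (lift ord0 i))).
  apply: fin_bigcap_measurable => // i _.
  by rewrite -[X in measurable X]setTI; exact: measurable_tnth.
by apply/seteqP; split => t H i => [_|]; exact: H.
Qed.

End lebesgue_tuple.

(* The identification of R^(2n^2) with the complex matrices: the first n^2
   coordinates are the real parts of the entries, the last n^2 the imaginary
   parts. *)
Definition cmx_of_tuple (R : realType) n
    (t : (n * n + n * n).-tuple (measurableTypeR R)) : 'M[R[i]]_n :=
  \matrix_(i, j) (tnth t (lshift _ (mxvec_index i j)) +i*
                  tnth t (rshift _ (mxvec_index i j))).

Lemma cmx_of_tuple_bij (R : realType) n : bijective (@cmx_of_tuple R n).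
Proof.
exists (fun A : 'M[R[i]]_n => [tuple match fintype.split k with
  | inl l => complex.Re (mxvec A 0 l)
  | inr l => complex.Im (mxvec A 0 l) end | k < n * n + n * n]).
  move=> t; apply: eq_from_tnth => k; rewrite tnth_mktuple.
  case: (split_ordP k) => l -> ; case/mxvec_indexP: l => i j;
  by rewrite mxvecE mxE.
move=> A; apply/matrixP => i j; rewrite mxE !tnth_mktuple.
rewrite (unsplitK (inl _)) (unsplitK (inr _)) mxvecE.
by case: (A i j).
Qed.

(* Main.v *)
Require Import Defs.
From HB Require Import structures.
From mathcomp Require Import all_boot all_order all_algebra generic_quotient.
From mathcomp Require Import spectral complex.
From mathcomp Require Import all_classical all_reals all_analysis.
From mathcomp Require Import ring.

(** Let d be the diagonal of Q^* A Q. Its sum is tr A for every unitary Q, and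
    f_A(Q) = |A|^2 - sum |d_i|^2. Splitting sum |d_i|^2 into its mean part
    |tr A|^2 / n and the deviation sum |d_i - tr A / n|^2
    (lemma [fA_deviation]) gives the upper bound, with equality exactly
    when Q^* A Q has constant diagonal. So both claims are about unitary
    matrices making the diagonal of A constant, equal to a := tr A / n.

    Such matrices are built one column at a time. A unit vector x with
    x^* A x = a exists because a is the mean of diagonal entries of A and the
    numerical range is convex ([numrange_convex], Toeplitz-Hausdorff). Any such
    x can serve as first column: in an orthonormal basis starting with x, the
    compression of A to the orthogonal complement has trace (n - 1) a, and
    induction applies to it ([const_diag_extend]).

    Since the first column is free up to the equation x^* A x = a |x|^2, and the
    flag remembers the line spanned by it, it remains to find uncountably many
    lines of solutions when n >= 3. After conjugating A to a matrix M with
    constant diagonal a, look for x = (1, v, w, 0, ...). The diagonal drops out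
    of the equation, leaving
      (M01 + M21 w^* ) v + (M10 + M12 w) v^* = - (M02 w + M20 w^* ).
    For fixed w this is a real-linear equation in v, of the form
    p v + q v^* = r, which is solvable when |p| <> |q|. If |M01| <> |M10|, then
    |p|^2 - |q|^2 is a nonzero polynomial in real w, so all real w but finitely
    many yield a solution. If |M01| = |M10|, then w = 0 leaves a homogeneous
    equation with a nonzero solution v, and hence all its real multiples. Either
    way there is a curve of pairwise distinct lines ([isotropic_curve]). *)

Set Implicit Arguments.
Unset Strict Implicit.
Unset Printing Implicit Defensive.

Import Order.TTheory GRing.Theory Num.Theory.
Import numFieldNormedType.Exports.

Local Open Scope classical_set_scope.
Local Open Scope ring_scope.
Local Open Scope sesquilinear_scope.

(** * Numerical range and its convexity *)

Section numerical_range.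
Context {C : numClosedFieldType}.

Definition sform n (A : 'M[C]_n) (x y : 'cV[C]_n) : C := (x ^t* *m A *m y) 0 0.

Lemma sformDl n (A : 'M[C]_n) x x' y :
  sform A (x + x') y = sform A x y + sform A x' y.
Proof. by rewrite /sform raddfD /= map_mxD !mulmxDl mxE. Qed.

Lemma sformDr n (A : 'M[C]_n) x y y' :
  sform A x (y + y') = sform A x y + sform A x y'.
Proof. by rewrite /sform mulmxDr mxE. Qed.

Lemma sformZl n (A : 'M[C]_n) a x y : sform A (a *: x) y = a^* * sform A x y.
Proof. by rewrite /sform linearZ /= map_mxZ -!scalemxAl mxE. Qed.

Lemma sformZr n (A : 'M[C]_n) a x y : sform A x (a *: y) = a * sform A x y.
Proof. by rewrite /sform -scalemxAr mxE. Qed.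

Lemma sform_sub_scalar n (A : 'M[C]_n) a x y :
  sform (A - a%:M) x y = sform A x y - a * sform 1%:M x y.
Proof.
rewrite /sform mulmxBr mulmxBl mulmx1 mul_mx_scalar -scalemxAl.
by rewrite [LHS]mxE; congr (_ + _); rewrite 2!mxE.
Qed.

Lemma sform_conj n (A Q : 'M[C]_n) x y :
  sform (Q ^t* *m A *m Q) x y = sform A (Q *m x) (Q *m y).
Proof. by rewrite /sform trmx_mul map_mxM !mulmxA. Qed.

Lemma sform_col n (A Q : 'M[C]_n) i j :
  (Q ^t* *m A *m Q) i j = sform A (col i Q) (col j Q).
Proof.
rewrite /sform tr_col map_row -row_mul /= !mxE; apply: eq_bigr => k _.
by rewrite !mxE.
Qed.

Lemma sform_delta n (A : 'M[C]_n) i j :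
  sform A (delta_mx i 0) (delta_mx j 0) = A i j.
Proof.
have := sform_col A 1%:M i j; rewrite trmx1 map_mx1 mul1mx mulmx1 !col1.
by move->.
Qed.

Lemma sform1_gt0 n (x : 'cV[C]_n) : x != 0 -> 0 < sform 1%:M x x.
Proof.
move=> x0; have : x ^t* != 0 by rewrite map_mx_eq0 trmx_eq0.
move=> /dotmx_is_dotmx; rewrite dotmxE /sform mulmx1.
by rewrite map_trmx trmxK map_mxCK.
Qed.

(** The vector is merely nonzero instead of a unit vector, so that no square
    root has to be taken to normalize it. *)
Definition in_numrange n (A : 'M[C]_n) (a : C) : Prop :=
  exists2 x : 'cV_n, x != 0 & sform A x x = a * sform 1%:M x x.

Lemma diag_in_numrange n (A : 'M[C]_n) i : in_numrange A (A i i).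
Proof.
exists (delta_mx i 0); last by rewrite !sform_delta mxE eqxx mulr1.
apply/eqP => /matrixP/(_ i 0); rewrite !mxE !eqxx => /eqP.
by rewrite oner_eq0.
Qed.

(** The core of the Toeplitz-Hausdorff theorem. Put z = x + t w y, where the
    complex number w is chosen to make the two cross terms add up to a real
    multiple g of the value at x. Then the form at z is that value times
    1 + g t - r |w|^2 t^2, a real quadratic in t with positive discriminant. *)
Lemma isotropic_between n (A : 'M[C]_n) (x y : 'cV[C]_n) (r : C) :
  x != 0 -> 0 < r -> sform A y y = - r * sform A x x ->
  exists2 z : 'cV_n, z != 0 & sform A z z = 0.
Proof.
move=> x0 r0 qy; have [qx0|qx0] := eqVneq (sform A x x) 0; first by exists x.
have [c qxy] : exists c, sform A x y = c * sform A x x.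
  by exists (sform A x y / sform A x x); rewrite divfK.
have [c' qyx] : exists c', sform A y x = c' * sform A x x.
  by exists (sform A y x / sform A x x); rewrite divfK.
(* That w c + w^* c' is its own conjugate amounts to w (c - c'^* ) being real,
   which leads to w = (c - c'^* )^* unless this vanishes. *)
have [w w0 g_real] : exists2 w : C, w != 0 & w * c + w^* * c' \is Num.real.
  have [cE|cN] := eqVneq (c - c'^*) 0.
    exists 1; rewrite ?oner_eq0// rmorph1 !mul1r.
    by apply/CrealP; rewrite rmorphD /= (subr0_eq cE) conjCK addrC.
  exists (c - c'^*)^*; rewrite ?conjC_eq0//.
  apply/CrealP; rewrite !(rmorphD, rmorphM, rmorphB, rmorphN)/= !conjCK.
  by ring.
set g := w * c + w^* * c' in g_real; pose rho := r * (w * w^*).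
have rho_gt0 : 0 < rho by rewrite mulr_gt0// mul_conjC_gt0.
have D_ge0 : 0 <= g ^+ 2 + 4%:R * rho.
  apply: addr_ge0; first by rewrite -realEsqr.
  by rewrite mulr_ge0 ?ler0n ?ltW.
pose t := (g + sqrtC (g ^+ 2 + 4%:R * rho)) / (2%:R * rho).
have t_real : t \is Num.real.
  apply: realM; first by apply: realD => //; rewrite ger0_real// sqrtC_ge0.
  by rewrite realV realM ?realn// gtr0_real.
have tC : t^* = t by apply/CrealP.
have tE : 1 + t * g - t ^+ 2 * rho = 0.
  have := sqrtCK (g ^+ 2 + 4%:R * rho); rewrite /t.
  move: (sqrtC _) => d dE; have {}dE : d ^+ 2 - (g ^+ 2 + 4%:R * rho) = 0.
    by rewrite dE subrr.
  have rho0 : rho != 0 by rewrite gt_eqF.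
  have -> : 1 + (g + d) / (2%:R * rho) * g - ((g + d) / (2%:R * rho)) ^+ 2 * rho
      = - (d ^+ 2 - (g ^+ 2 + 4%:R * rho)) / (4%:R * rho) by field.
  by rewrite dE oppr0 mul0r.
exists (x + (t * w) *: y).
  (* If z = 0, then x is a multiple of y, so the values at x and y differ by a
     nonnegative factor, against the hypothesis. *)
  rewrite addr_eq0 -scaleNr; apply/eqP => xE.
  have : (1 + r * (t * w * (t * w)^*)) * sform A x x = 0.
    rewrite mulrDl mul1r {1 2}xE sformZl sformZr qy rmorphN /=; ring.
  apply/eqP; rewrite mulf_neq0// gt_eqF// ltr_wpDr// mulr_ge0 ?(ltW r0)//.
  exact: mul_conjC_ge0.
rewrite sformDl !sformDr sformZl !sformZr sformZl qy qxy qyx rmorphM /= tC.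
transitivity ((1 + t * g - t ^+ 2 * rho) * sform A x x); last first.
  by rewrite tE mul0r.
by rewrite /g /rho; ring.
Qed.

(** For m := s a + t b, it suffices to find a nonzero isotropic vector of
    A - m. The values of A - m at x and y are
    t (a - b) |x|^2 and - s (a - b) |y|^2, negatively proportional as
    [isotropic_between] requires. *)
Lemma numrange_convex n (A : 'M[C]_n) (a b s t : C) :
  0 < s -> 0 < t -> s + t = 1 ->
  in_numrange A a -> in_numrange A b -> in_numrange A (s * a + t * b).
Proof.
move=> s0 t0 st [x x0 qx] [y y0 qy]; set m := s * a + t * b.
have [nx ny] := (sform1_gt0 x0, sform1_gt0 y0).
have [||z z0 qz] := @isotropic_between n (A - m%:M) x y
  (s * sform 1%:M y y / (t * sform 1%:M x x)) x0.
- by rewrite divr_gt0// mulr_gt0.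
- rewrite !sform_sub_scalar qx qy /m (_ : s = 1 - t); last by rewrite -st addrK.
  by field; rewrite !gt_eqF.
by exists z => //; apply/eqP; rewrite -subr_eq0 -sform_sub_scalar qz.
Qed.

Lemma mean_in_numrange n (A : 'M[C]_n) (d : nat -> C) k :
  (forall i, (i <= k)%N -> in_numrange A (d i)) ->
  in_numrange A ((\sum_(i < k.+1) d i) / k.+1%:R).
Proof.
elim: k => [|k IH] dA; first by rewrite big_ord1 divr1; exact: dA.
rewrite big_ord_recr /=.
have k1 : k.+1%:R != 0 :> C by rewrite pnatr_eq0.
have k2 : k.+2%:R != 0 :> C by rewrite pnatr_eq0.
set S := \sum_(i < _) _.
have -> : (S + d k.+1) / k.+2%:R =
    (k.+1%:R / k.+2%:R) * (S / k.+1%:R) + k.+2%:R^-1 * d k.+1.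
  move: (k.+1%:R) (k.+2%:R) k1 k2 => p q p0 q0.
  by field; rewrite p0 q0.
apply: numrange_convex; rewrite ?divr_gt0 ?invr_gt0 ?ltr0n//.
- by rewrite -[X in _ + X]mul1r -mulrDl natr1 divff.
- by apply: IH => i ik; apply: dA; exact: leqW.
- exact: dA.
Qed.

(** This provides the first column of the unitary matrix sought. *)
Lemma mean_diag_in_numrange n (A : 'M[C]_n.+1) :
  in_numrange A (\tr A / n.+1%:R).
Proof.
have := @mean_in_numrange _ A (fun i => A (inord i) (inord i)) n.
rewrite /mxtrace; under eq_bigr do rewrite inord_val.
by apply => i _; exact: diag_in_numrange.
Qed.

(** * Unitary matrices making the diagonal constant *)

(** Gram-Schmidt on a matrix all of whose rows are x^T keeps the line of its
    first row and completes it to an orthonormal basis. *)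
Lemma unitary_with_first_col n (x : 'cV[C]_n.+1) :
  exists2 U : 'M[C]_n.+1, U \is unitarymx & exists c, x = c *: col 0 U.
Proof.
pose V : 'M[C]_n.+1 := \matrix_(i, j) x j 0.
have row_V : row 0 V = x^T by apply/rowP => j; rewrite !mxE.
exists (schmidt V)^T; first by rewrite trmx_unitary schmidt_unitarymx.
have := row_schmidt_sub V 0; rewrite (big_pred1 0) => [|i]; last first.
  by rewrite leqn0.
rewrite genmxE row_V => /sub_rVP[c xE]; exists c.
by apply: trmx_inj; rewrite linearZ /= tr_col trmxK.
Qed.

Lemma mxtrace_unitary_conj n (A U : 'M[C]_n) :
  U \is unitarymx -> \tr (U ^t* *m A *m U) = \tr A.
Proof. by move=> /unitarymxP uU; rewrite mxtrace_mulC mulmxA uU mul1mx. Qed.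

Definition const_diag n (A : 'M[C]_n) (a : C) (Q : 'M[C]_n) : Prop :=
  Q \is unitarymx /\ forall i, (Q ^t* *m A *m Q) i i = a.

Lemma const_diag_mul n (A U Q : 'M[C]_n) a : U \is unitarymx ->
  const_diag (U ^t* *m A *m U) a Q -> const_diag A a (U *m Q).
Proof.
move=> uU [uQ dQ]; split=> [|i]; first exact: mul_unitarymx.
by rewrite -(dQ i) trmx_mul map_mxM !mulmxA.
Qed.

(** Conjugating by a unitary U whose first column spans the line of x puts a in
    the corner of the matrix; the lower right block then has trace n a, so some
    P makes its diagonal constant, and U * diag(1, P) does the job for A without
    changing the first column. The first hypothesis is the induction hypothesis
    of [const_diag_exists]; stating the step separately keeps the freedom in the
    choice of x, which the count of maximizers relies on. *)
Lemma const_diag_extend n (A : 'M[C]_n.+1) a (x : 'cV_n.+1) :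
    (forall B : 'M[C]_n, \tr B = n%:R * a -> exists Q, const_diag B a Q) ->
    \tr A = n.+1%:R * a -> x != 0 -> sform A x x = a * sform 1%:M x x ->
  exists2 Q : 'M[C]_n.+1, const_diag A a Q & exists c, x = c *: col 0 Q.
Proof.
move=> IH trA x0 qx; have [U uU [c xE]] := unitary_with_first_col x.
have c0 : c != 0 by apply: contraNneq x0 => c0; rewrite xE c0 scale0r.
have [M ME] : exists M : 'M[C]_(1 + n), M = U ^t* *m A *m U by eexists.
have M00 : M 0 0 = a.
  rewrite ME sform_col; have := qx; rewrite xE !(sformZl, sformZr).
  have -> : sform 1%:M (col 0 U) (col 0 U) = 1.
    rewrite -sform_col mulmx1.
    have /mulmx1C -> : U *m U ^t* = 1%:M by exact/unitarymxP.
    by rewrite mxE.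
  rewrite mulr1 [RHS]mulrC -!mulrA => /mulfI; rewrite conjC_eq0 => /(_ c0).
  by move/(mulfI c0).
have ulM : ulsubmx M = a%:M.
  apply/matrixP => i j; rewrite !ord1 !mxE eqxx mulr1n -M00.
  by congr (M _ _); apply/val_inj.
have [|P [uP dP]] := IH (drsubmx M).
  have trM : \tr M = a + \tr (drsubmx M).
    by rewrite -[M in LHS]submxK mxtrace_block ulM mxtrace_scalar.
  have := mxtrace_unitary_conj A uU; rewrite -ME trM trA => trE.
  by apply: (addrI a); rewrite trE mulrS; ring.
pose Q' : 'M[C]_(1 + n) := block_mx 1%:M 0 0 P.
have Q'E : Q' ^t* = block_mx 1%:M 0 0 (P ^t*).
  by rewrite tr_block_mx map_block_mx !trmx0 !map_mx0 trmx1 map_mx1.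
have uQ' : Q' \is unitarymx.
  apply/unitarymxP; rewrite Q'E mulmx_block (unitarymxP uP).
  by rewrite !(mulmx0, mul0mx, mul1mx, addr0, add0r) -scalar_mx_block.
have conjM : Q' ^t* *m M *m Q' = block_mx a%:M (ursubmx M *m P)
    (P ^t* *m dlsubmx M) (P ^t* *m drsubmx M *m P).
  rewrite -[M in LHS]submxK Q'E !mulmx_block ulM.
  by rewrite !(mulmx0, mul0mx, mul1mx, mulmx1, addr0, add0r).
exists (U *m Q').
  apply: const_diag_mul => //; split=> // i; rewrite -ME conjM.
  case: (@split_ordP 1 n i) => j ->; last first.
    exact: etrans (block_mxEdr _ _ _ _ _ _) (dP j).
  by apply: etrans (block_mxEul _ _ _ _ _ _) _; rewrite ord1 mxE eqxx mulr1n.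
exists c; rewrite xE; congr (_ *: _); rewrite !colE -mulmxA; congr (_ *m _).
have -> : 0 = @lshift 1 n 0 :> 'I_n.+1 by exact/val_inj.
rewrite -colE.
apply/matrixP => i j; rewrite ord1 {j}; case: (@split_ordP 1 n i) => j ->.
  rewrite [RHS]mxE; apply/esym/(etrans (block_mxEul _ _ _ _ _ _)).
  by rewrite !mxE !ord1 !eqxx.
rewrite [RHS]mxE; apply/esym/(etrans (block_mxEdl _ _ _ _ _ _)).
by rewrite !mxE.
Qed.

Lemma const_diag_exists n (A : 'M[C]_n) a :
  \tr A = n%:R * a -> exists Q, const_diag A a Q.
Proof.
elim: n A => [|n IH] A trA.
  exists 1%:M; split=> [|[]//].
  by apply/unitarymxP; rewrite trmx1 map_mx1 mulmx1.
have [x x0 qx] := mean_diag_in_numrange A.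
have [|Q QA _] := @const_diag_extend _ A a x IH trA x0; last by exists Q.
by rewrite qx trA [_ * a]mulrC mulfK ?pnatr_eq0.
Qed.

End numerical_range.

(** * Curves of isotropic vectors *)

Section real_linear.
Context {C : numClosedFieldType}.
Implicit Types p q r v : C.

(** Over the reals, v |-> p v + q v^* has determinant |p|^2 - |q|^2; the
    solution below is Cramer's rule for the equation and its conjugate. *)
Lemma real_linear_solve p q r :
  p * p^* - q * q^* != 0 -> exists v, p * v + q * v^* = r.
Proof.
move=> N0; exists ((p^* * r - q * r^*) / (p * p^* - q * q^*)).
rewrite !(rmorphM, rmorphB, fmorphV)/= !conjCK.
rewrite (mulrC p^*) (mulrC q^*); field.
by rewrite (mulrC _ p) (mulrC _ q).
Qed.

Lemma real_linear_kernel p q :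
  p * p^* - q * q^* = 0 -> exists2 v, v != 0 & p * v + q * v^* = 0.
Proof.
move=> N0.
(* Up to a sign, p v + q v^* is g^* (|p|^2 - |q|^2) at v = g q - g^* p^*. At
   least one of g = 1 and g = 'i gives v != 0, unless p = q = 0. *)
have kerE g : p * (g * q - g^* * p^*) + q * (g * q - g^* * p^*)^* = 0.
  rewrite !(rmorphM, rmorphB)/= !conjCK.
  by transitivity (- g^* * (p * p^* - q * q^*)); [ring|rewrite N0 mulr0].
have [e1|n1] := eqVneq (1 * q - 1^* * p^*) 0; last by eexists; [exact: n1|].
have [ei|ni] := eqVneq ('i * q - 'i^* * p^*) 0; last by eexists; [exact: ni|].
exists 1; first exact: oner_neq0.
have qE : q = p^* by apply/eqP; rewrite -subr_eq0 -e1 rmorph1 !mul1r.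
move: ei; rewrite qE conjCi mulNr opprK -mulr2n => /eqP.
rewrite mulrn_eq0 mulf_eq0 (negPf (neq0Ci _)) conjC_eq0 /= => /eqP ->.
by rewrite rmorph0 !mul0r addr0.
Qed.

Lemma countable_roots (P : {poly C}) : P != 0 -> countable [set z | root P z].
Proof.
move=> P0; have [s sE] := closed_field_poly_normal P.
apply: finite_set_countable; apply/finite_seqP; exists s.
have rootE z : root P z = (z \in s).
  by rewrite sE rootZ ?lead_coef_eq0// root_prod_XsubC.
by apply/seteqP; split=> z /=; rewrite rootE.
Qed.

End real_linear.

Section uncountable.
Context {R : realType}.

(** Otherwise the whole real line would have Lebesgue measure zero. *)
Lemma cocountable_uncountable (T : set R) : countable (~` T) -> ~ countable T.
Proof.
move=> cT' cT; have : countable [set: R].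
  rewrite -(setUv T) -bigcup2E; apply: bigcup_countable => // -[|[|n]] _ //=.
move/countable_lebesgue_measure0; rewrite -set_itvNyy lebesgue_measure_itv/=.
by [].
Qed.

(** The equation says that the form of a zero-diagonal matrix with entries b_ij
    vanishes at (1, v t, w t). As the first coordinate is 1, injectivity of the
    pair (v, w) makes the lines spanned by these vectors distinct. *)
Lemma isotropic_curve (b01 b10 b02 b20 b12 b21 : R[i]) :
  exists (T : set R) (v w : R -> R[i]),
  [/\ ~ countable T,
      forall s t, T s -> T t -> v s = v t -> w s = w t -> s = t &
      forall t, T t -> b01 * v t + b10 * (v t)^* + b02 * w t + b20 * (w t)^*
                       + b12 * (v t)^* * w t + b21 * v t * (w t)^* = 0].
Proof.
have realC (t : R) : ((t%:C)%C : R[i])^* = (t%:C)%C by exact: conjc_real.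
have [N0|N0] := eqVneq (b01 * b01^* - b10 * b10^*) 0.
  (* A real line of solutions inside the span of the first two vectors. *)
  have [u u0 uE] := real_linear_kernel N0.
  exists setT, (fun t => (t%:C)%C * u), (fun=> 0); split.
  - by apply: cocountable_uncountable; rewrite setCT.
  - by move=> s t _ _ /(mulIf u0)/complexI.
  - move=> t _; rewrite rmorph0 rmorphM /= realC.
    by rewrite !mulr0 !addr0 mulrCA [b10 * _]mulrCA -mulrDr uE mulr0.
(* P is the determinant |p|^2 - |q|^2 as a function of w, written without
   conjugating w because only real values of w are used. *)
pose P : {poly R[i]} :=
  (b01%:P + b21%:P * 'X) * (b01^*%:P + b21^*%:P * 'X) -
  (b10%:P + b12%:P * 'X) * (b10^*%:P + b12^*%:P * 'X).
pose T := [set t : R | P.[(t%:C)%C] != 0].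
have /boolp.choice[v vE] : forall t : R, exists y : R[i], T t ->
    (b01 + b21 * (t%:C)%C) * y + (b10 + b12 * (t%:C)%C) * y^* =
    - ((b02 + b20) * (t%:C)%C).
  move=> t.
  have [tT|tT] := pselect (T t); last by exists 0.
  have [|y yE] := @real_linear_solve _ (b01 + b21 * (t%:C)%C)
    (b10 + b12 * (t%:C)%C) (- ((b02 + b20) * (t%:C)%C)); last by exists y.
  by rewrite !rmorphD !rmorphM /= realC; move: tT; rewrite /T /= !hornerE.
exists T, v, (fun t => (t%:C)%C); split.
- apply: cocountable_uncountable.
  have /countable_injP[f injf] : countable [set z | root P z].
    apply: countable_roots; apply: contraNneq N0 => P0.
    by have := congr1 (fun p : {poly _} => p.[0]) P0; rewrite !hornerE => ->.
  apply/countable_injP; exists (f \o real_complex R) => s t.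
  rewrite !inE /T /= => /negP/negPn sP /negP/negPn tP fst.
  by apply: complexI; apply: injf => //; rewrite inE.
- by move=> s t _ _ _ /complexI.
- move=> t /vE e; rewrite realC.
  by rewrite -[RHS](subrr (- ((b02 + b20) * (t%:C)%C))) -{1}e; ring.
Qed.

End uncountable.

(** * The objective function and its maximizers *)

Lemma sum_sqr_dev (C : numClosedFieldType) n (d : 'I_n.+1 -> C) :
  \sum_i `|d i - (\sum_j d j) / n.+1%:R| ^+ 2 =
  \sum_i `|d i| ^+ 2 - n.+1%:R^-1 * `|\sum_j d j| ^+ 2.
Proof.
have n0 : n.+1%:R != 0 :> C by rewrite pnatr_eq0.
set S := \sum_j d j; set m := S / _.
have mE : S = n.+1%:R * m by rewrite mulrC divfK.
clearbody m.
have dE i : `|d i - m| ^+ 2 = `|d i| ^+ 2 - (d i * m^* + m * (d i)^* - m * m^*).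
  by rewrite !normCK rmorphB /=; ring.
rewrite (eq_bigr _ (fun i _ => dE i)) sumrB; congr (_ - _).
rewrite sumrB big_split /= -mulr_suml -mulr_sumr -rmorph_sum /= -/S.
rewrite sumr_const card_ord -[_ *+ n.+1]mulr_natl normCK mE rmorphM rmorph_nat.
move: n.+1%:R n0 => N N0; field; exact: N0.
Qed.

Section objective.
Context {R : realType}.

Lemma frob2E n (X : 'M[R[i]]_n) : frob2 X = \sum_i \sum_j `|X j i| ^+ 2.
Proof.
apply: eq_bigr => i _; rewrite mxE; apply: eq_bigr => j _.
by rewrite !mxE normCK mulrC.
Qed.

Lemma frob2_offdiag n (X : 'M[R[i]]_n) :
  frob2 (offdiag X) = frob2 X - \sum_i `|X i i| ^+ 2.
Proof.
rewrite !frob2E -sumrB; apply: eq_bigr => i _.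
rewrite (bigD1 i)//= [in RHS](bigD1 i)//= addrC [in RHS]addrC addrK.
rewrite !mxE eqxx mulr1n subrr normr0 expr0n addr0.
by apply: eq_bigr => j /negPf ji; rewrite !mxE ji mulr0n subr0.
Qed.

Lemma fA_deviation n (A : 'M[R[i]]_n.+1) (Q : unitary_group R n.+1) :
  fA A Q = frob2 A - n.+1%:R^-1 * `|\tr A| ^+ 2
    - \sum_i `|(Q ^t* *m A *m Q) i i - \tr A / n.+1%:R| ^+ 2.
Proof.
have uQ : umx Q \is unitarymx := valP Q.
rewrite /fA frob2_offdiag frob2_unitary// -(mxtrace_unitary_conj A uQ).
by rewrite sum_sqr_dev; ring.
Qed.

Lemma fA_const_diag n (A : 'M[R[i]]_n.+1) (Q : unitary_group R n.+1) :
  const_diag A (\tr A / n.+1%:R) Q ->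
  fA A Q = frob2 A - n.+1%:R^-1 * `|\tr A| ^+ 2.
Proof.
move=> [_ dQ]; rewrite fA_deviation big1 ?subr0// => i _.
by rewrite dQ subrr normr0 expr0n.
Qed.

(** The lines spanned by the columns of a unitary matrix are invariants of its
    class, by which the maximizers below are told apart. *)
Lemma flag_eq_col n (P Q : unitary_group R n) j :
  \pi_(flag R n)%qT P = \pi_(flag R n)%qT Q -> exists d, col j Q = d *: col j P.
Proof.
move=> /eqquotP /asboolP[D /andP[/diag_mxP[d ->] _] ->].
exists (d 0 j); apply/colP => i; rewrite mul_mx_diag !mxE; exact: mulrC.
Qed.

(** Each vector of an [isotropic_curve], read in a basis where A has constant
    diagonal, extends to a maximizer whose first column spans its line, so that
    the parameter t injects into the set of maximizing flags. *)
Lemma uncountable_max_flags n (A : 'M[R[i]]_n.+3) :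
  ~ countable [set q : flag R n.+3 |
      flag_fA A q = frob2 A - n.+3%:R^-1 * `|\tr A| ^+ 2].
Proof.
have n0 : n.+3%:R != 0 :> R[i] by rewrite pnatr_eq0.
pose a := \tr A / n.+3%:R.
have trA : \tr A = n.+3%:R * a by rewrite mulrC divfK.
have [Q0 [uQ0 dQ0]] := const_diag_exists trA.
have [M ME] : exists M, M = Q0 ^t* *m A *m Q0 by eexists.
rewrite -ME in dQ0.
pose i0 : 'I_n.+3 := Ordinal (isT : (0 < n.+3)%N).
pose i1 : 'I_n.+3 := Ordinal (isT : (1 < n.+3)%N).
pose i2 : 'I_n.+3 := Ordinal (isT : (2 < n.+3)%N).
have [T [v [w [cT injT zeroT]]]] := isotropic_curve
  (M i0 i1) (M i1 i0) (M i0 i2) (M i2 i0) (M i1 i2) (M i2 i1).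
pose y t : 'cV[R[i]]_n.+3 :=
  delta_mx i0 0 + v t *: delta_mx i1 0 + w t *: delta_mx i2 0.
have y0 t : y t i0 0 = 1 by rewrite !mxE/= !mulr0 !addr0.
have y1 t : y t i1 0 = v t by rewrite !mxE/= mulr1 mulr0 add0r addr0.
have y2 t : y t i2 0 = w t by rewrite !mxE/=; rewrite mulr0 mulr1 !add0r.
have yE B t : sform B (y t) (y t) =
    B i0 i0 + v t * (v t)^* * B i1 i1 + w t * (w t)^* * B i2 i2 +
    (B i0 i1 * v t + B i1 i0 * (v t)^* + B i0 i2 * w t + B i2 i0 * (w t)^*
     + B i1 i2 * (v t)^* * w t + B i2 i1 * v t * (w t)^*).
  rewrite /y !(sformDl, sformDr, sformZl, sformZr) !sform_delta; ring.
pose x t := Q0 *m y t.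
have QK : Q0 ^t* *m Q0 = 1%:M by apply: mulmx1C; exact/unitarymxP.
have yx t : y t = Q0 ^t* *m x t by rewrite mulmxA QK mul1mx.
have x0 t : x t != 0.
  apply/eqP => xt0; have := y0 t; rewrite yx xt0 mulmx0 mxE => /eqP.
  by rewrite eq_sym oner_eq0.
have qx t : T t -> sform A (x t) (x t) = a * sform 1%:M (x t) (x t).
  move=> Tt; rewrite -!sform_conj mulmx1 QK -ME !yE zeroT// !dQ0 !mxE/=.
  by ring.
have /boolp.choice[Q QP] : forall t, exists Q : unitary_group R n.+3,
    T t -> const_diag A a Q /\ exists c, x t = c *: col 0 Q.
  move=> t; have [Tt|nTt] := pselect (T t); last first.
    by exists (UnitaryGroup uQ0).
  have [P PA Px] :=
    const_diag_extend (@const_diag_exists _ _ ^~ a) trA (x0 t) (qx t Tt).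
  by exists (UnitaryGroup PA.1).
move=> /countable_injP[f injf]; apply: cT; apply/countable_injP.
exists (fun t => f (\pi_(flag R n.+3)%qT (Q t))) => s t; rewrite !inE => Ts Tt.
have maxQ r : T r -> \pi_(flag R n.+3)%qT (Q r) \in [set q : flag R n.+3 |
      flag_fA A q = frob2 A - n.+3%:R^-1 * `|\tr A| ^+ 2].
  by move=> /QP[QA _]; rewrite inE /= flag_fAE fA_const_diag.
move=> /(injf _ _ (maxQ s Ts) (maxQ t Tt))/(flag_eq_col 0)[d dE].
have [_ [c cE]] := QP s Ts; have [_ [c' c'E]] := QP t Tt.
have c0 : c != 0 by apply: contraNneq (x0 s) => c0; rewrite cE c0 scale0r.
have ytE : y t = (c' * d / c) *: y s.
  by rewrite !yx c'E dE cE -!scalemxAr !scalerA divfK.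
(* Proportional vectors with first coordinate 1 are equal. *)
have e1 : c' * d / c = 1.
  by have := y0 t; rewrite ytE mxE y0 mulr1.
by apply: injT => //; rewrite -?y1 -?y2 ytE e1 scale1r.
Qed.

End objective.

(* Opened only here: this scope reads the conjugation ^* as the one of R[i],
   which hides the generic conjugation of the lemmas above. *)
Local Open Scope complex_scope.

Theorem theorem3p2 (R : realType) (n : nat) (hn : (1 <= n)%N) :
  (forall A : 'M[R[i]]_n,
    (exists Q : unitary_group R n,
      fA A Q = frob2 A - n%:R^-1 * `|\tr A| ^+ 2) /\
    (forall Q : unitary_group R n,
      fA A Q <= frob2 A - n%:R^-1 * `|\tr A| ^+ 2)) /\
  ((3 <= n)%N ->
    {ae lebesgue_tuple (n * n + n * n), forall t,
      let A : 'M[R[i]]_n := cmx_of_tuple t in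
      ~ countable [set q : flag R n |
          flag_fA A q = frob2 A - n%:R^-1 * `|\tr A| ^+ 2]}).
Proof.
split=> [A|n3].
  case: n hn A => // n _ A; split=> [|Q].
    have [|Q QA] := @const_diag_exists _ _ A (\tr A / n.+1%:R).
      by rewrite mulrC divfK// pnatr_eq0.
    by exists (UnitaryGroup QA.1); exact: fA_const_diag.
  rewrite fA_deviation gerBl.
  by apply: sumr_ge0 => i _; rewrite exprn_ge0.
apply: aeW => t /=.
by case: n hn n3 t => [|[|[|n]]]// _ _ t; exact: uncountable_max_flags.
Qed.
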